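(* Let $n,k$ be positive integers. The multiplicative inverse function $f_{\mathrm{inv}}$ on $\mathbb F_{2^n}$ is not $k$th order sum-free if and only if there exist $u_1,\dots,u_k\in\mathbb F_{2^n}$ such that $\Delta(u_1,\dots,u_k)\ne 0$ but $\Theta_k(u_1,\dots,u_k)=0$.
   Context: $f_{\mathrm{inv}}(x)=x^{-1}$ for $x\ne0$ and $f_{\mathrm{inv}}(0)=0$. A function $f:\mathbb F_{2^n}\to\mathbb F_{2^n}$ is $k$th order sum-free if $\sum_{x\in A}f(x)\ne 0$ for every $k$-dimensional $\mathbb F_2$-affine subspace $A$ of $\mathbb F_{2^n}$. $\Delta(X_1,\dots,X_k)=\det\bigl(X_j^{2^{i}}\bigr)_{0\le i\le k-1,\,1\le j\le k}\in\mathbb F_2[X_1,\dots,X_k]$ is the Moore determinant over $\mathbb F_2$. A $2$-adic partition is a partition all of whose parts are powers of $2$; $\Lambda_k$ is the set of $2$-adic partitions of $2^{k-1}$ with at most $k$ parts. For a partition $\lambda$ with at most $k$ parts, $m_\lambda(X_1,\dots,X_k)$ is the monomial symmetric polynomial (sum of all distinct monomials $X_1^{\alpha_1}\cdots X_k^{\alpha_k}$ where $(\alpha_1,\dots,\alpha_k)$ is a permutation of $\lambda$ padded with zeros). Define $\Theta_k=\sum_{\lambda\in\Lambda_k}m_\lambda(X_1,\dots,X_k)\in\mathbb F_2[X_1,\dots,X_k]$. *)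

(* Defs.v *)
From HB Require Import structures.
From mathcomp Require Import all_boot all_order all_fingroup all_algebra all_field.
From mathcomp.multinomials Require Import mpoly.

Set Implicit Arguments.
Unset Strict Implicit.
Unset Printing Implicit Defensive.

Import GRing.Theory.
Local Open Scope ring_scope.

(* A field F_(2^n) is an extension F of 'F_2 with \dim {:F} = n; its finite   *)
(* type structure is carried by the alias finvect_type F of F.                *)

Definition f_inv (F : fieldType) (x : F) : F := if x == 0 then 0 else x^-1.

(* A is a translate of a k-dimensional 'F_2-subspace of F.                    *)
Definition affine_subspace (F : fieldExtType 'F_2) (k : nat)
    (A : {set finvect_type F}) : Prop :=
  exists (a : F) (V : {vspace F}),
    \dim V = k /\ A = [set x : finvect_type F | (x : F) - a \in V].

Definition sum_free (F : fieldExtType 'F_2) (k : nat) (f : F -> F) : Prop :=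
  forall A : {set finvect_type F}, affine_subspace k A ->
    \sum_(x in A) f x <> 0.

Definition Moore_det (k : nat) : {mpoly 'F_2[k]} :=
  \det (\matrix_(i < k, j < k) ('X_j ^+ (2 ^ i)%N : {mpoly 'F_2[k]})).

Definition is_partition (N : nat) (s : seq nat) : bool :=
  [&& sorted geq s, all (fun p => 0 < p)%N s & sumn s == N].

(* The exponent i can be bounded by p because i < 2 ^ i.                      *)
Definition power_of_2 (p : nat) : bool := [exists i : 'I_p, p == (2 ^ i)%N].

Definition is_2adic_partition (N : nat) (s : seq nat) : bool :=
  is_partition N s && all power_of_2 s.

(* Partitions with at most k parts are bounded sequences; a part of a         *)
(* partition of N is at most N, so taking parts in 'I_N.+1 loses nothing and  *)
(* makes the collection a finite set.                                         *)
Definition Lambda (k : nat) : {set {bseq k of 'I_(2 ^ k.-1).+1}} :=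
  [set s : {bseq k of 'I_(2 ^ k.-1).+1}
     | is_2adic_partition (2 ^ k.-1) (map val s)].

Definition padded (k : nat) (s : seq nat) : seq nat :=
  s ++ nseq (k - size s) 0%N.

(* The exponent vectors of the monomials occurring in m_s all have degree     *)
(* sumn s, hence the finite index type 'X_{1..k < (sumn s).+1}.               *)
Definition monomial_sym (k : nat) (s : seq nat) : {mpoly 'F_2[k]} :=
  \sum_(a : 'X_{1..k < (sumn s).+1} | perm_eq [seq a i | i : 'I_k] (padded k s))
    'X_[a].

Definition Theta (k : nat) : {mpoly 'F_2[k]} :=
  \sum_(s in Lambda k) monomial_sym k (map val s).

Definition eval_at (F : fieldExtType 'F_2) (k : nat) (p : {mpoly 'F_2[k]})
    (u : 'I_k -> F) : F :=
  (map_mpoly (in_alg F) p).@[u].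

(* Main.v *)
Require Import Defs.
From HB Require Import structures.
From mathcomp Require Import all_boot all_order all_fingroup all_algebra all_field.
From mathcomp.multinomials Require Import mpoly.
From mathcomp Require Import zify.

(* Let V be a k-dimensional F_2-subspace with basis v and annihilator
   polynomial P = sum_i b_i X^(2^i) = prod_(x in V) (X - x). Logarithmic
   differentiation gives sum_(x in V) 1/(a - x) = b_0 / P(a) <> 0 for a outside
   V, so only linear subspaces matter, and sum_(x in V \ 0) 1/x = 0 iff b_1 = 0.

   On the other side, let T_j = sum_(i <= k) (u_j t)^(2^i). The coefficients d_i
   of t^(2^k - 2^i) in prod_j (1 + T_j) satisfy sum_i d_i u_j^(2^i) = 0 and
   d_k = 1: indeed (1 + T_j) T_j = u_j t + (u_j t)^(2^(k+1)), and 2^k - 1 is not a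
   sum of fewer than k powers of 2. So the d_i are the coefficients b_i of the
   span of u, and Theta(u) = d_(k-1).

   The two conditions b_1 = 0 and b_(k-1) = 0 are exchanged by a duality: b_s = 0
   iff some nonzero y is orthogonal to the vectors (v_j^(2^i))_j, i <= k, i <> s.
   If y is such a vector for v and s = 1, then (v_j^(2^k))_j is one for y and
   s = k - 1, and conversely since the Frobenius map is bijective. *)

Set Implicit Arguments.
Unset Strict Implicit.
Unset Printing Implicit Defensive.

Import GRing.Theory.
Local Open Scope ring_scope.

(** * Linear algebra of square systems *)

Section SquareSystems.
Variables (F : fieldType) (k : nat).

Lemma det_neq0_row (A : 'M[F]_k) : \det A != 0 ->
  forall c : 'I_k -> F, (forall j, \sum_i c i * A i j = 0) -> forall i, c i = 0.
Proof.
move=> dA c cA i; have uA : A \in unitmx by rewrite unitmxE unitfE.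
have : (\row_i c i) *m A = 0.
  by apply/rowP => j; rewrite !mxE -[RHS](cA j); apply: eq_bigr => i' _; rewrite mxE.
move/(congr1 (mulmxr (invmx A))); rewrite /= mulmxK // mul0mx.
by move/rowP/(_ i); rewrite !mxE.
Qed.

Lemma det_eq0_row (A : 'M[F]_k) : \det A = 0 ->
  exists2 c : 'I_k -> F, (exists i, c i != 0) & forall j, \sum_i c i * A i j = 0.
Proof.
move/eqP/det0P => [c /rV0Pn[i ci] /rowP cA]; exists (c 0); first by exists i.
by move=> j; have := cA j; rewrite !mxE.
Qed.

Lemma det_neq0P (A : 'M[F]_k) :
  (forall c : 'I_k -> F, (forall j, \sum_i c i * A i j = 0) -> forall i, c i = 0) ->
  \det A != 0.
Proof.
move=> H; apply/negP => /eqP/det_eq0_row[c [i /eqP ci] cA].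
by apply: ci; apply: H.
Qed.

Lemma det_neq0_col (A : 'M[F]_k) : \det A != 0 ->
  forall y : 'I_k -> F, (forall i, \sum_j A i j * y j = 0) -> forall j, y j = 0.
Proof.
rewrite -det_tr => dA y Ay; apply: (det_neq0_row dA) => i.
by rewrite -[RHS](Ay i); apply: eq_bigr => j _; rewrite mxE mulrC.
Qed.

Lemma det_eq0_col (A : 'M[F]_k) : \det A = 0 ->
  exists2 y : 'I_k -> F, (exists j, y j != 0) & forall i, \sum_j A i j * y j = 0.
Proof.
rewrite -det_tr => /det_eq0_row[y y0 Ay]; exists y => // i.
by rewrite -[RHS](Ay i); apply: eq_bigr => j _; rewrite mxE mulrC.
Qed.

(** The first [k] of the [k.+1] rows are independent, so every relation among the rows is a multiple
    of [b]. Hence [b s] vanishes iff the rows other than [s], which form the square matrix [R], are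
    dependent, that is, iff [R] has a nonzero kernel vector. *)
Lemma relation_coef_eq0 (r : 'I_k.+1 -> 'I_k -> F) (b : 'I_k.+1 -> F) s :
    \det (\matrix_(i < k, j < k) r (lift ord_max i) j) != 0 ->
    b ord_max = 1 -> (forall j, \sum_i b i * r i j = 0) ->
  b s = 0 <-> exists2 y : 'I_k -> F, (exists j, y j != 0) &
                forall i, i != s -> \sum_j r i j * y j = 0.
Proof.
move=> dr bmax br; set R := \matrix_(i < k, j < k) r (lift s i) j.
split=> [bs0 | [y [j0 yj0] ry]].
  have /det_eq0_col[y y0 Ry] : \det R = 0.
    (* Dropping the entry [b s = 0] leaves a relation among the rows of [R], nonzero because it
       still contains the last entry 1. *)
    apply/eqP/det0P; exists (\row_i b (lift s i)).
      case: (unliftP s ord_max) => [i Ei | Es].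
        by apply/rV0Pn; exists i; rewrite mxE -Ei bmax oner_eq0.
      by move: bs0; rewrite -Es bmax => /eqP; rewrite oner_eq0.
    apply/rowP => j; rewrite !mxE -[RHS](br j) (bigD1_ord s) //= bs0 mul0r add0r.
    by apply: eq_bigr => i _; rewrite !mxE.
  exists y => // i; case: (unliftP s i) => [i' -> _ | -> /eqP//].
  by rewrite -[RHS](Ry i'); apply: eq_bigr => j _; rewrite mxE.
have /det_eq0_row[c [i0 ci0] cR] : \det R = 0.
  apply/eqP; apply: contraNT yj0 => dR; apply/eqP; apply: (det_neq0_col dR) => i.
  by rewrite -[RHS](ry (lift s i)) ?(eq_sym _ s) ?neq_lift //; apply: eq_bigr => j _; rewrite mxE.
pose c' i := if unlift s i is Some i' then c i' else 0.
have c's : c' s = 0 by rewrite /c' unlift_none.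
have c'l i : c' (lift s i) = c i by rewrite /c' liftK.
have c'r j : \sum_i c' i * r i j = 0.
  rewrite (bigD1_ord s) //= c's mul0r add0r -[RHS](cR j).
  by apply: eq_bigr => i _; rewrite c'l mxE.
(* Subtracting the multiple of [b] with the same last entry leaves a relation among the first [k]
   rows, which must be trivial. *)
pose d i := c' i - c' ord_max * b i.
have dmax : d ord_max = 0 by rewrite /d bmax mulr1 subrr.
have d0 i : d i = 0.
  case: (unliftP ord_max i) => [{}i -> | -> //].
  move: i; apply: (det_neq0_row dr (c := fun i => d (lift ord_max i))) => j.
  transitivity (\sum_i d i * r i j).
    rewrite [RHS](bigD1_ord ord_max) //= dmax mul0r add0r.
    by apply: eq_bigr => i1 _; rewrite mxE.
  rewrite /d; under eq_bigr do rewrite mulrBl -mulrA.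
  by rewrite sumrB c'r -mulr_sumr br mulr0 subrr.
have c'E i : c' i = c' ord_max * b i by apply/eqP; rewrite -subr_eq0; apply/eqP/d0.
apply/eqP; have /eqP := c'E s; rewrite c's eq_sym mulf_eq0 => /orP[/eqP m0|//].
by move: ci0; rewrite -c'l c'E m0 mul0r eqxx.
Qed.

End SquareSystems.

(** * Moore matrices in characteristic 2 and their Frobenius duality *)

Section Char2.

Lemma expr_sum_char2 (R : comNzRingType) (ch : 2 \in [pchar R]) m I r (P : pred I) (E : I -> R) :
  (\sum_(i <- r | P i) E i) ^+ (2 ^ m) = \sum_(i <- r | P i) E i ^+ (2 ^ m).
Proof.
apply: (big_morph (fun x => x ^+ (2 ^ m))) => [x y|]; last first.
  by rewrite expr0n expn_eq0.
apply: exprDn_pchar; rewrite pnatX; apply/orP; left.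
by rewrite pnatE.
Qed.

Definition moore_mx (F : fieldType) k (v : 'I_k -> F) : 'M[F]_k :=
  \matrix_(i < k, j < k) v j ^+ (2 ^ i).

Variables (F : fieldType) (char2 : 2 \in [pchar F]).

Section Duality.
Variables (k : nat) (v y : 'I_k -> F).
Hypothesis k0 : (0 < k)%N.
Let g i := \sum_j v j ^+ (2 ^ i) * y j.

(** The common twist by [2 ^ i] factors out, so pairings of twists reduce to the values of [g]. *)
Lemma moore_pairing i m : (i <= m)%N ->
  \sum_j v j ^+ (2 ^ m) * y j ^+ (2 ^ i) = g (m - i) ^+ (2 ^ i).
Proof.
move=> im; rewrite expr_sum_char2 //; apply: eq_bigr => j _.
by rewrite exprMn -exprM -expnD subnK.
Qed.

Hypothesis g0 : forall i, (i <= k)%N -> i != 1%N -> g i = 0.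

Lemma moore_dual_perp i : (i <= k)%N -> i != k.-1 ->
  \sum_j y j ^+ (2 ^ i) * v j ^+ (2 ^ k) = 0.
Proof.
move=> ik ik1; under eq_bigr do rewrite mulrC.
rewrite moore_pairing // g0 ?leq_subr //; last first.
  apply: contra ik1 => /eqP e; apply/eqP; rewrite -(subKn ik) e; by rewrite subn1.
by rewrite expr0n expn_eq0.
Qed.

(** Otherwise [y] would be orthogonal to every row of a nonsingular Moore matrix. *)
Lemma pairing1_neq0 : \det (moore_mx v) != 0 -> (exists j, y j != 0) -> g 1 != 0.
Proof.
move=> dv [j yj]; apply: contraNN yj => /eqP g1; apply/eqP.
apply: (det_neq0_col dv) => i.
rewrite -[RHS](_ : g i = 0); last first.
  by have [->//|] := eqVneq (i : nat) 1%N; apply: g0; apply: ltnW.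
by apply: eq_bigr => j' _; rewrite mxE.
Qed.

(** Triangular elimination. Pairing a row relation [c] of the Moore matrix of [y] with the twist
    [k - m] of [v] leaves, among the rows of index below [k - m], only row [k - m - 1], with the
    factor [g 1 ^+ (2 ^ i)]. So the entries of [c] vanish one by one, starting from the last. *)
Lemma moore_dual_neq0 : g 1 != 0 -> \det (moore_mx y) != 0.
Proof.
move=> g1; apply: det_neq0P => c cy.
have H m : (m < k)%N -> \sum_(i < k) c i * (\sum_j v j ^+ (2 ^ (k - m)) * y j ^+ (2 ^ i)) = 0.
  move=> mk; under eq_bigr do rewrite mulr_sumr.
  rewrite exchange_big /= big1 // => j _.
  under eq_bigr do rewrite mulrCA.
  rewrite -mulr_sumr -[X in _ * X](_ : 0 = _) ?mulr0 //.
  by rewrite -[LHS](cy j); apply: eq_bigr => i _; rewrite mxE.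
have C m : (m < k)%N -> forall i : 'I_k, i = (k - m).-1 :> nat -> c i = 0.
  elim/ltn_ind: m => m IH mk i Ei.
  have := H m mk; rewrite (bigD1 i) //= [X in _ + X]big1 ?addr0 => [|i' ii'].
    rewrite moore_pairing; last by rewrite Ei leq_pred.
    rewrite (_ : (k - m - i)%N = 1%N); last first.
      by rewrite Ei -subn1 subKn // subn_gt0.
    by move/eqP; rewrite mulf_eq0 expf_eq0 (negPf g1) andbF orbF => /eqP.
  case: (ltnP i i') => [lt | le].
    have lk := ltn_ord i'.
    rewrite (IH (k - i'.+1)%N) ?mul0r //.
    1-3: lia.
  have lt : (i' < i)%N by rewrite ltn_neqAle ii'.
  have ikm : i.+1 = (k - m)%N by rewrite Ei prednK // subn_gt0.
  rewrite moore_pairing; last by rewrite -ikm; apply: leqW.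
  rewrite g0 ?expr0n ?expn_eq0 ?mulr0 //.
    by rewrite -subnDA leq_subr.
  by rewrite -ikm subSn // eqSS subn_eq0 -ltnNge.
move=> i; apply: (C (k - i.+1)%N); last by rewrite subKn.
by rewrite ltn_subLR // addSn ltnS leq_addl.
Qed.

End Duality.

Section Codual.
Variables (k : nat) (u v : 'I_k -> F).
Hypothesis k0 : (0 < k)%N.
Hypothesis du : \det (moore_mx u) != 0.
Hypothesis v0 : exists j, v j != 0.
Hypothesis h0 : forall i, (i <= k)%N -> i != k.-1 ->
  \sum_j u j ^+ (2 ^ i) * v j ^+ (2 ^ k) = 0.
Let g i := \sum_j v j ^+ (2 ^ i) * u j.

Lemma expr2_eq0 i (x : F) : (x ^+ (2 ^ i) == 0) = (x == 0).
Proof. by rewrite expf_eq0 expn_gt0. Qed.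

Let gE i : (i <= k)%N ->
  \sum_j u j ^+ (2 ^ (k - i)) * v j ^+ (2 ^ k) = g i ^+ (2 ^ (k - i)).
Proof.
move=> ik; under eq_bigr do rewrite mulrC.
by rewrite moore_pairing ?leq_subr // subKn.
Qed.

Lemma moore_codual_perp i : (i <= k)%N -> i != 1%N -> g i = 0.
Proof.
move=> ik i1; apply/eqP; rewrite -(expr2_eq0 (k - i)) -gE // h0 ?leq_subr //.
by apply: contra i1 => /eqP e; apply/eqP; lia.
Qed.

(** The elimination now runs upwards: against the twist [m] of [u], row [m] gives a power of [g 1],
    later rows give 0, and earlier coefficients are already known to vanish. *)
Lemma moore_codual_neq0 : \det (moore_mx v) != 0.
Proof.
(* If [g 1] were 0, the hypothesis [h0] would extend to the index [k.-1], and the twist [2 ^ k] of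
   [v] would be a kernel vector of the Moore matrix of [u]. *)
have g1 : g 1 != 0.
  have [j vj] := v0; apply: contraNN vj => /eqP g1.
  rewrite -(expr2_eq0 k); apply/eqP.
  move: j; apply: (det_neq0_col du (y := fun j => v j ^+ (2 ^ k))) => i.
  under eq_bigr do rewrite mxE.
  have [e|] := eqVneq (i : nat) k.-1; last by apply: h0; apply: ltnW.
  by rewrite e -subn1 gE // g1 expr0n expn_eq0.
(* The rows used are the first [k] Frobenius twists of [v ^ 2], so that only
   the pairings [g i] with [0 <= i <= k] occur. *)
suff : \det (moore_mx (fun j => v j ^+ 2)) != 0.
  (* Squaring the entries of a row relation for [v] gives one for the squares of [v]. *)
  apply: contraNN => /det0P[c c0 /rowP cv]; apply/det0P.
  exists (map_mx (fun x => x ^+ 2) c).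
    have /rV0Pn[i ci] := c0.
    by apply/rV0Pn; exists i; rewrite mxE (expr2_eq0 1).
  apply/rowP => j; move: (cv j); rewrite !mxE => /(congr1 (fun x => x ^+ (2 ^ 1))).
  rewrite expr_sum_char2 // expn1 expr0n /= => cvj; rewrite -[RHS]cvj.
  by apply: eq_bigr => i _; rewrite !mxE [RHS]exprMn -[in LHS]exprM -[in RHS]exprM mulnC.
apply: det_neq0P => c cv.
have H m : \sum_(i < k) c i * (\sum_j v j ^+ (2 ^ i.+1) * u j ^+ (2 ^ m)) = 0.
  under eq_bigr do rewrite mulr_sumr.
  rewrite exchange_big /= big1 // => j _.
  under eq_bigr do rewrite mulrA.
  rewrite -mulr_suml -[X in X * _](_ : 0 = _) ?mul0r //.
  by rewrite -[LHS](cv j); apply: eq_bigr => i _; rewrite mxE -exprM expnS.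
have C m : forall i : 'I_k, i = m :> nat -> c i = 0.
  elim/ltn_ind: m => m IH i Ei.
  have := H m; rewrite (bigD1 i) //= [X in _ + X]big1 ?addr0 => [|i' ii'].
    rewrite moore_pairing; last by rewrite Ei.
    by rewrite Ei subSnn => /eqP; rewrite mulf_eq0 expr2_eq0 (negPf g1) orbF => /eqP.
  case: (ltnP i' i) => [lt | le].
    by rewrite (IH i') ?mul0r // -Ei.
  have lt : (i < i')%N by rewrite ltn_neqAle eq_sym ii'.
  rewrite moore_pairing; last by rewrite -Ei; apply: leqW.
  rewrite -/(g _) moore_codual_perp ?expr0n ?expn_eq0 ?mulr0 //.
    by apply: leq_trans (leq_subr _ _) _; apply: ltn_ord.
  by rewrite -Ei subSn // eqSS subn_eq0 -ltnNge.
by move=> i; apply: (C i).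
Qed.

End Codual.
End Char2.

(** * Binary digit sums and products of polynomials with power-of-2 exponents *)

Lemma power_of_2P p : reflect (exists i, p = 2 ^ i)%N (power_of_2 p).
Proof.
apply: (iffP existsP) => [[i /eqP ->]|[i ->]]; first by exists i.
by exists (Ordinal (ltn_expl i (isT : 1 < 2)%N)).
Qed.

Definition part_or_0 p := (p == 0%N) || power_of_2 p.

Lemma logn2_fact_pow2 i : (logn 2 (2 ^ i)`!).+1 = (2 ^ i)%N.
Proof.
have ltS j : (j < 2 ^ j)%N by apply: ltn_expl.
rewrite logn_fact // (big_cat_nat (n := i.+1)) //=; last exact/ltnW/ltS.
rewrite [X in (_ + X)%N]big1_seq ?addn0 => [|j /=]; last first.
  by rewrite mem_index_iota => /andP[ij _]; rewrite divn_small // ltn_exp2l.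
elim: i => [|i IH]; first by rewrite big_geq.
rewrite big_nat_recl // expn1 expnS mulKn // -addnS mulSn mul1n; congr (_ + _)%N.
rewrite -[RHS]IH; congr _.+1; apply: eq_bigr => j _.
by rewrite addnn -mul2n expnS divnMl.
Qed.

Lemma logn2_factD a b :
  (logn 2 a`! + logn 2 b`! <= logn 2 (a + b)`!)%N.
Proof.
rewrite -lognM ?fact_gt0 //; apply: dvdn_leq_log; first exact: fact_gt0.
by rewrite -(bin_fact (leq_addr b a)) addKn dvdn_mull.
Qed.

(* By Legendre, [N - logn 2 N`!] is the binary digit sum of [N], which is
   subadditive and equal to 1 on powers of 2. *)
Lemma prod_coef_digit_sum (R : comNzRingType) m (A : 'I_m -> {poly R}) N :
    (forall i e, (A i)`_e != 0 -> part_or_0 e) ->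
  (\prod_(i < m) A i)`_N != 0 -> (N <= m + logn 2 N`!)%N.
Proof.
elim: m A N => [|m IH] A N HA.
  by rewrite big_ord0 coef1; case: N => //= N; rewrite eqxx.
rewrite big_ord_recr /= coefM => nz.
have [i /andP[nzP nzA]] : exists i : 'I_N.+1,
    ((\prod_(i < m) A (widen_ord (leqnSn m) i))`_i != 0) && ((A ord_max)`_(N - i) != 0).
  apply/existsP; apply: contraNT nz; rewrite negb_exists => /forallP H.
  apply/eqP/big1 => i _; have := H i; rewrite negb_and !negbK.
  by case/orP => /eqP ->; rewrite ?mul0r ?mulr0.
have le_i := IH _ _ (fun i => HA _) nzP.
have le_e : (N - i <= 1 + logn 2 (N - i)`!)%N.
  by case/orP: (HA _ _ nzA) => [/eqP -> // | /power_of_2P[e ->]]; rewrite add1n logn2_fact_pow2.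
have iN : (i <= N)%N by rewrite -ltnS.
have := logn2_factD i (N - i); rewrite (subnKC iN).
move: (logn 2 _) (logn 2 _) (logn 2 _) le_i le_e => a b c le_i le_e le_abc.
lia.
Qed.

(** The digit sum of [2 ^ k - 1] is [k], read off from the factorization of the factorial of [2 ^ k]
    as [2 ^ k] times that of its predecessor. *)
Lemma prod_coef_pow2_pred (R : comNzRingType) m k (A : 'I_m -> {poly R}) :
    (forall i e, (A i)`_e != 0 -> part_or_0 e) -> (m < k)%N ->
  (\prod_(i < m) A i)`_(2 ^ k).-1 = 0.
Proof.
move=> HA mk; apply/eqP; apply: contraTT mk => /(prod_coef_digit_sum HA).
have := logn2_fact_pow2 k; have e : (2 ^ k)%N = (2 ^ k).-1.+1 by rewrite prednK ?expn_gt0.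
rewrite {1}e factS -e lognM ?expn_gt0 ?fact_gt0 // lognX logn_prime // eqxx.
move: (logn 2 _) => c; lia.
Qed.

(** * The polynomials [T_j] and the coefficients [d_i] *)

Section Artin.
Variables (F : fieldType) (char2 : 2 \in [pchar F]) (k : nat).

(** [T_j] for [x = u j], with ['X] in the role of t: a truncation of the power series root of the
    Artin-Schreier equation [T + T ^ 2 = x t]. *)
Definition pow2_poly (x : F) : {poly F} := \sum_(i < k.+1) (x *: 'X) ^+ (2 ^ i).

Lemma coef_pow2_poly x e :
  (pow2_poly x)`_e = if (e <= 2 ^ k)%N && power_of_2 e then x ^+ e else 0.
Proof.
rewrite coef_sum; under eq_bigr do rewrite exprZn coefZ coefXn.
case: ifP => [/andP[le /power_of_2P[i Ei]] | ne].
  have lt : (i < k.+1)%N by rewrite ltnS -(@leq_exp2l 2) // -Ei.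
  rewrite (bigD1 (Ordinal lt)) //= -Ei eqxx mulr1 big1 ?addr0 // => j ji.
  rewrite Ei eqn_exp2l // eq_sym; case: eqP; rewrite ?mulr0 // => ij.
  by case/eqP: ji; apply: val_inj.
rewrite big1 // => i _; case: eqP => [Ei|]; rewrite ?mulr0 //.
case/negP: (negbT ne); rewrite Ei leq_exp2l // -ltnS ltn_ord /=.
by apply/power_of_2P; exists i.
Qed.

Lemma coef_pow2_poly_factor x e :
  (1 + pow2_poly x)`_e = if (e <= 2 ^ k)%N && part_or_0 e then x ^+ e else 0.
Proof.
rewrite coefD coef1 coef_pow2_poly /part_or_0; case: e => [|e] /=; last by rewrite add0r.
case: ifP => [/power_of_2P[i /eqP]|_]; last by rewrite addr0.
by rewrite eq_sym expn_eq0.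
Qed.

(** Squaring shifts the summation index, so [T + T ^ 2] telescopes to its two end terms. *)
Lemma artin_pow2_poly x :
  (1 + pow2_poly x) * pow2_poly x = x *: 'X + (x *: 'X) ^+ (2 ^ k.+1).
Proof.
have chP : 2 \in [pchar {poly F}] by rewrite (pchar_lalg {poly F}).
rewrite mulrDl mul1r -expr2 /pow2_poly -[2%N]/(2 ^ 1)%N expr_sum_char2 //.
under [X in _ + X]eq_bigr do rewrite -exprM -expnSr.
rewrite big_ord_recl big_ord_recr /= -addrA (addrA (\sum_(i < k) _)) -big_split /=.
rewrite [X in X + (x *: _) ^+ _](_ : _ = 0) ?add0r //.
by apply: big1 => i _; apply: (addrr_pchar2 chP).
Qed.

Variable u : 'I_k -> F.
(** The [d_i]. The complementary exponent makes multiplication by the [i]-th term of [T_j] land in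
    degree [2 ^ k]. *)
Definition dickson_coef i := (\prod_j (1 + pow2_poly (u j)))`_(2 ^ k - 2 ^ i).

Lemma dickson_coef_lead : dickson_coef k = 1.
Proof.
rewrite /dickson_coef subnn -horner_coef0 horner_prod big1 // => j _.
by rewrite horner_coef0 coef_pow2_poly_factor.
Qed.

(** The sum is the coefficient of degree [2 ^ k] in the full product times [T_j]. After
    [artin_pow2_poly] the term of degree [2 ^ k.+1] is too high to matter, and the linear term calls
    for degree [2 ^ k - 1] in a product of only [k - 1] factors. *)
Lemma dickson_coef_relation j : \sum_(i < k.+1) dickson_coef i * u j ^+ (2 ^ i) = 0.
Proof.
have -> : \sum_(i < k.+1) dickson_coef i * u j ^+ (2 ^ i) =
   ((\prod_j (1 + pow2_poly (u j))) * pow2_poly (u j))`_(2 ^ k).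
  rewrite /pow2_poly mulr_sumr coef_sum; apply: eq_bigr => i _.
  rewrite exprZn -scalerAr coefZ coefMXn ltnNge leq_exp2l // -ltnS ltn_ord /=.
  by rewrite mulrC.
rewrite (bigD1_ord j) //= mulrAC artin_pow2_poly mulrC mulrDr coefD.
rewrite exprZn -!scalerAr !coefZ coefMX coefMXn expn_eq0 /= ltn_exp2l // ltnSn mulr0 addr0.
rewrite prod_coef_pow2_pred ?mulr0 //; last by have := ltn_ord j; lia.
move=> i e; rewrite coef_pow2_poly_factor; case: ifP => [/andP[]//|].
by rewrite eqxx.
Qed.

End Artin.

(** * [Theta] as a coefficient of the product of the [1 + T_j] *)

Definition parts (l : seq nat) := sort geq [seq p <- l | (0 < p)%N].

Lemma perm_padded_parts l : perm_eq l (padded (size l) (parts l)).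
Proof.
rewrite -(perm_filterC (fun p => 0 < p)%N l) /padded; apply: perm_cat.
  by rewrite perm_sym perm_sort.
rewrite size_sort size_filter -(count_predC (fun p => 0 < p)%N l) addKn.
rewrite -size_filter; set s := filter _ _.
suff /all_pred1P <- : all (pred1 0%N) s by [].
by apply/allP => p; rewrite mem_filter /= lt0n negbK => /andP[].
Qed.

(** Discarding zeros undoes the padding, and a sorted list is determined by its multiset; so an
    exponent vector comes from at most one partition. *)
Lemma padded_inj k l s : sorted geq s -> all (fun p => 0 < p)%N s ->
  perm_eq l (padded k s) -> s = parts l.
Proof.
move=> s_sorted s_pos /(perm_filter (fun p => 0 < p)%N).
rewrite filter_cat (all_filterP s_pos) (_ : filter _ (nseq _ _) = [::]) ?cats0; last first.
  by apply/eqP; rewrite -[_ == _]negbK -has_filter; apply/hasPn => p /nseqP[->].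
move=> ls; apply: (@sorted_eq _ geq) => //.
- by move=> a b c /= ba cb; apply: leq_trans cb ba.
- by move=> a b; rewrite /= andbC => /anti_leq.
- by apply: sort_sorted => a b; rewrite /= leq_total.
- by rewrite perm_sym perm_sort.
Qed.

(** Replaces the index type depending on [s] by a fixed one, so that the sums in [Theta] can be
    exchanged. *)
Lemma monomial_symE k s N : sumn s = N ->
  monomial_sym k s =
  \sum_(a : 'X_{1..k < N.+1} | perm_eq [seq a i | i : 'I_k] (padded k s)) 'X_[a].
Proof. by move=> <-. Qed.

Lemma sumn_exponents k (a : 'X_{1..k}) : sumn [seq a i | i : 'I_k] = mdeg a.
Proof. by rewrite sumnE big_image mdegE. Qed.

Lemma perm_LambdaP k (a : 'X_{1..k}) : let N := (2 ^ k.-1)%N in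
  (exists2 s : {bseq k of 'I_N.+1}, s \in Lambda k
     & perm_eq [seq a i | i : 'I_k] (padded k (map val s))) <->
  mdeg a = N /\ forall i, part_or_0 (a i).
Proof.
move=> N; set l := [seq a i | i : 'I_k].
have size_l : size l = k by rewrite size_image card_ord.
split=> [[s] | [degN good]].
  rewrite inE /is_2adic_partition /is_partition => /andP[/and3P[_ _ /eqP sumN] pow] perm.
  split=> [|i].
    rewrite -sumn_exponents (perm_sumn perm) sumn_cat sumN.
    by rewrite sumn_nseq mul0n addn0.
  have : a i \in l by apply: image_f.
  rewrite (perm_mem perm) mem_cat => /orP[si|/nseqP[-> //]].
  by rewrite /part_or_0 (allP pow) ?orbT.
have perm := perm_padded_parts l; rewrite size_l in perm.
have sumN : sumn (parts l) = N.
  by rewrite -degN -sumn_exponents (perm_sumn perm) sumn_cat sumn_nseq mul0n addn0.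
(* This bound keeps [inord] below from falling back on its default value. *)
have le_N p : p \in parts l -> (p <= N)%N.
  move=> pl; have := sumN; rewrite (perm_sumn (perm_to_rem pl)) /= => <-.
  by rewrite leq_addr.
have size_s : (size (map (@inord N) (parts l)) <= k)%N.
  by rewrite size_map size_sort size_filter -[X in (_ <= X)%N]size_l count_size.
have vals : map val (Bseq size_s) = parts l.
  rewrite /= -map_comp -[RHS]map_id; apply/eq_in_map => p /le_N pN /=.
  by rewrite inordK.
exists (Bseq size_s); last by rewrite vals.
rewrite inE vals /is_2adic_partition /is_partition sumN eqxx andbT.
rewrite sort_sorted /= => [|p q]; last by rewrite /= leq_total.
rewrite !all_sort; apply/andP; split; apply/allP => p; rewrite mem_filter => /andP[p0] //.
by case/imageP => i _ Ep; have := good i; rewrite -Ep /part_or_0 eqn0Ngt p0.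
Qed.

(** Each admissible monomial occurs for exactly one partition, so nothing cancels modulo 2. *)
Lemma Theta_monomials k : let N := (2 ^ k.-1)%N in
  Theta k = \sum_(a : 'X_{1..k < N.+1} | (mdeg a == N) && [forall i, part_or_0 (a i)]) 'X_[a].
Proof.
move=> N; rewrite /Theta.
under eq_bigr => s sL.
  rewrite (@monomial_symE _ _ N); last first.
    by move: sL; rewrite inE => /andP[/and3P[_ _ /eqP]].
  over.
rewrite (exchange_big_dep xpredT) //= [RHS]big_mkcond /=; apply: eq_bigr => a _.
case: ifP => [/andP[/eqP degN /forallP good] | bad]; last first.
  apply: big1 => s /andP[sL perm]; case/negP: (negbT bad).
  have [|-> good] := (perm_LambdaP a).1; first by exists s.
  by rewrite eqxx; apply/forallP.
have [s sL perm] := (perm_LambdaP a).2 (conj degN good).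
have partsE t : t \in Lambda k -> perm_eq [seq a i | i : 'I_k] (padded k (map val t)) ->
    map val t = parts [seq a i | i : 'I_k].
  rewrite inE => /andP[/and3P[sorted_t pos_t _] _]; exact: padded_inj.
rewrite (big_pred1 s) // => t; apply/andP/eqP => [[tL pt] | -> //].
apply: val_inj; apply: (inj_map val_inj).
by rewrite (partsE t) // (partsE s).
Qed.

Lemma eval_at_sum (F : fieldExtType 'F_2) k (u : 'I_k -> F) I r (P : pred I) p :
  eval_at (\sum_(i <- r | P i) p i) u = \sum_(i <- r | P i) eval_at (p i) u.
Proof.
by rewrite /eval_at (raddf_sum (map_mpoly (in_alg F))) (raddf_sum (meval u)).
Qed.

Lemma eval_atX (F : fieldExtType 'F_2) k (u : 'I_k -> F) a :
  eval_at 'X_[a] u = \prod_j u j ^+ a j.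
Proof. by rewrite /eval_at map_mpolyX mevalX. Qed.

Lemma eval_Moore (F : fieldExtType 'F_2) k (u : 'I_k -> F) :
  eval_at (Moore_det k) u = \det (moore_mx u).
Proof.
rewrite /eval_at /Moore_det -!det_map_mx; congr (\det _).
by apply/matrixP => i j; rewrite !mxE !rmorphXn /= map_mpolyX mevalXU.
Qed.

(** Since [2 ^ k - 2 ^ k.-1 = 2 ^ k.-1], expanding the product and extracting this degree picks
    exactly the exponent vectors of [Theta_monomials]. *)
Lemma eval_Theta (F : fieldExtType 'F_2) k (u : 'I_k -> F) : (0 < k)%N ->
  eval_at (Theta k) u = dickson_coef u k.-1.
Proof.
move=> k0; set N := (2 ^ k.-1)%N.
have EN : (2 ^ k - 2 ^ k.-1)%N = N by rewrite -{1}(prednK k0) expnS mul2n -addnn addnK.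
have leN : (N <= 2 ^ k)%N by rewrite leq_exp2l // leq_pred.
rewrite /dickson_coef EN Theta_monomials eval_at_sum -/N.
under [LHS]eq_bigr do rewrite eval_atX.
pose D := (2 ^ k)%N.
have factE j : 1 + pow2_poly k (u j) =
    \sum_(e < D.+1) (if part_or_0 e then u j ^+ e else 0) *: 'X^e.
  rewrite -(poly_def D.+1 (fun e => if part_or_0 e then u j ^+ e else 0)).
  by apply/polyP => e; rewrite coef_poly coef_pow2_poly_factor ltnS; case: leqP.
rewrite (eq_bigr _ (fun j _ => factE j)).
rewrite bigA_distr_bigA /= coef_sum.
have termE (f : {ffun 'I_k -> 'I_D.+1}) :
    (\prod_j ((if part_or_0 (f j) then u j ^+ f j else 0) *: 'X^(f j)) : {poly F})`_N =
    if (\sum_j f j == N)%N && [forall j, part_or_0 (f j)] then \prod_j u j ^+ f j else 0.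
  rewrite scaler_prod prodrXr coefZ coefXn eq_sym.
  case: eqP => _ /=; last by rewrite mulr0.
  rewrite mulr1; case: ifP => [/forallP good | /negbT].
    by apply: eq_bigr => j _; rewrite good.
  rewrite negb_forall => /existsP[j bad].
  by rewrite (bigD1 j) //= (negPf bad) mul0r.
under [RHS]eq_bigr do rewrite termE.
rewrite -big_mkcond /=.
(* A default for [insubd], never reached by choices of exponents with sum [N]. *)
have m0 : 'X_{1..k < N.+1} by apply: (@BMultinom _ _ 0%MM); rewrite mdeg0.
pose to_mnm (f : {ffun 'I_k -> 'I_D.+1}) := insubd m0 [multinom val (f j) | j < k].
pose of_mnm (a : 'X_{1..k < N.+1}) : {ffun 'I_k -> 'I_D.+1} := [ffun j => inord (a j)].
have of_mnmE a j : of_mnm a j = a j :> nat.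
  rewrite ffunE inordK // ltnS (leq_trans _ leN) // -ltnS.
  apply: leq_ltn_trans (bmdeg a); rewrite mdegE (bigD1 j) //=; exact: leq_addr.
have to_mnmE (f : {ffun 'I_k -> 'I_D.+1}) :
    (\sum_j f j = N)%N -> to_mnm f = [multinom val (f j) | j < k] :> 'X_{1..k}.
  move=> sumf; rewrite /to_mnm val_insubd mdegE.
  by under eq_bigr do rewrite mnmE; rewrite sumf ltnS leqnn.
rewrite [RHS](reindex_onto of_mnm to_mnm) /=; last first.
  move=> f /andP[/eqP sumf _]; apply/ffunP => j; apply: val_inj.
  by rewrite /= of_mnmE to_mnmE // mnmE.
apply: eq_big => [a | a _]; last by apply: eq_bigr => j _; rewrite of_mnmE.
under [in RHS]eq_bigr do rewrite of_mnmE.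
rewrite -mdegE; under [in RHS]eq_forallb do rewrite of_mnmE.
rewrite -andbA; case: eqP => //= degN; case: [forall _, _] => //=.
apply/esym/eqP/val_inj; apply/mnmP => j; rewrite [val (to_mnm _)]to_mnmE ?mnmE.
  exact: of_mnmE.
by under eq_bigr do rewrite of_mnmE; rewrite -mdegE.
Qed.

(** * Linearized polynomials, subspaces and sums of inverses *)

Lemma deriv_prod_XsubC (F : fieldType) (s : seq F) c : c \notin s ->
  (\prod_(x <- s) ('X - x%:P))^`().[c] =
  (\prod_(x <- s) ('X - x%:P)).[c] * \sum_(x <- s) (c - x)^-1.
Proof.
elim: s => [|x s IH]; first by rewrite !big_nil derivC hornerC mulr0.
rewrite inE negb_or => /andP[cx cs].
rewrite !big_cons derivM derivXsubC mul1r hornerD !hornerM hornerXsubC IH //.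
rewrite mulrDr mulrAC mulfV ?subr_eq0 // mul1r; congr (_ + _).
by rewrite mulrA.
Qed.

Section LinearizedPolynomial.
Variables (F : fieldType) (char2 : 2 \in [pchar F]).

Definition linpoly m (b : nat -> F) : {poly F} := \sum_(i < m) b i *: 'X^(2 ^ i).

Lemma horner_linpoly m b x : (linpoly m b).[x] = \sum_(i < m) b i * x ^+ (2 ^ i).
Proof.
by rewrite horner_sum; apply: eq_bigr => i _; rewrite hornerZ hornerXn.
Qed.

Lemma coef_linpoly m b i : (i < m)%N -> (linpoly m b)`_(2 ^ i) = b i.
Proof.
move=> im; rewrite coef_sum (bigD1 (Ordinal im)) //= coefZ coefXn eqxx mulr1.
rewrite big1 ?addr0 // => j ji; rewrite coefZ coefXn eqn_exp2l // eq_sym.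
case: eqP => [e|]; last by rewrite mulr0.
by case/eqP: ji; apply: val_inj.
Qed.

Lemma size_linpoly m b : (size (linpoly m.+1 b) <= (2 ^ m).+1)%N.
Proof.
apply: (leq_trans (size_sum _ _ _)); apply/bigmax_leqP => i _.
apply: (leq_trans (size_scale_leq _ _)); rewrite size_polyXn ltnS leq_exp2l //.
by rewrite -ltnS.
Qed.

(** All exponents but [2 ^ 0] are even. *)
Lemma deriv_linpoly m b : (linpoly m.+1 b)^`() = (b 0%N)%:P.
Proof.
rewrite /linpoly raddf_sum /= big_ord_recl /= big1 ?addr0 => [|i _].
  by rewrite derivZ derivXn expn0 expr0 -mul_polyC mulr1.
rewrite derivZ derivXn -scaler_nat expnS natrM.
by rewrite (pcharf0 char2) mul0r scale0r scaler0.
Qed.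

End LinearizedPolynomial.

Section Subspace.
Variable F : fieldExtType 'F_2.

Lemma fieldExt_char2 : 2 \in [pchar F].
Proof. by rewrite (pchar_lalg F) pchar_Fp. Qed.
Let char2 := fieldExt_char2.

Lemma F2_expr2 (e : 'F_2) i : e ^+ (2 ^ i) = e.
Proof.
have e2 : e ^+ 2 = e by case: e => [[|[|]]] // ?; apply: val_inj.
by elim: i => [|i IH] //; rewrite expnSr exprM IH.
Qed.

Lemma horner_linpoly_comb m b k (e : 'I_k -> 'F_2) (v : 'I_k -> F) :
  (linpoly m b).[\sum_j e j *: v j] = \sum_j e j *: (linpoly m b).[v j].
Proof.
under [RHS]eq_bigr do rewrite horner_linpoly scaler_sumr.
rewrite horner_linpoly exchange_big; apply: eq_bigr => i _ /=.
rewrite expr_sum_char2 // mulr_sumr; apply: eq_bigr => j _.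
by rewrite exprZn F2_expr2 scalerAr.
Qed.

Variables (k : nat) (V : {vspace F}).
Hypothesis dimV : \dim V = k.

(** Typed over [F] rather than its finite alias, so that it can serve as a list of roots of
    polynomials over [F]. *)
Let Vseq : seq F := enum [set x : finvect_type F | (x : F) \in V].

Lemma mem_Vseq x : (x \in Vseq) = (x \in V).
Proof.
have := mem_enum [set y : finvect_type F | (y : F) \in V] (x : finvect_type F).
by rewrite inE.
Qed.

Lemma uniq_Vseq : uniq Vseq.
Proof. exact: enum_uniq. Qed.

Lemma sum_Vseq (f : F -> F) :
  \sum_(x <- Vseq) f x = \sum_(x in [set x : finvect_type F | (x : F) \in V]) f x.
Proof. exact: (@big_enum _ _ _ (finvect_type F) [set x : finvect_type F | (x : F) \in V] f). Qed.

Lemma size_Vseq : size Vseq = (2 ^ k)%N.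
Proof.
have -> : size Vseq = #|[set x : finvect_type F | (x : F) \in V]| by rewrite cardE.
rewrite -dimV cardsE.
have := @card_vspace 'F_2 (finvect_type F) _ (V : {vspace (finvect_type F)}).
by rewrite card_Fp.
Qed.

Lemma poly_vanish_subspace (p : {poly F}) :
  (size p <= 2 ^ k)%N -> {in V, forall x, p.[x] = 0} -> p = 0.
Proof.
move=> sp pV; apply/eqP; apply: contraTT sp => p0; rewrite -ltnNge -size_Vseq.
apply: max_poly_roots => //; last exact: uniq_Vseq.
by apply/allP => x; rewrite mem_Vseq => /pV px; apply/rootP.
Qed.

(** A row relation is the coefficient list of a linearized polynomial of degree below [2 ^ k] that
    vanishes on all [2 ^ k] elements of [V]. *)
Lemma moore_basis_neq0 (v : 'I_k -> F) :
    {in V, forall x, exists e : 'I_k -> 'F_2, x = \sum_j e j *: v j} ->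
  \det (moore_mx v) != 0.
Proof.
move=> gen; apply: det_neq0P => c cv.
case: k dimV v gen c cv => [|k'] dimV' v gen c cv; first by case.
pose b i := c (inord i).
have p0 : linpoly k'.+1 b = 0.
  apply: poly_vanish_subspace.
    by apply: (leq_trans (size_linpoly _ _)); rewrite ltn_exp2l // -dimV dimV'.
  move=> x /gen[e ->]; rewrite horner_linpoly_comb big1 // => j _.
  rewrite horner_linpoly -[X in _ *: X](_ : 0 = _) ?scaler0 //.
  by rewrite -[LHS](cv j); apply: eq_bigr => i _; rewrite mxE /b inord_val.
move=> i; have := coef_linpoly b (ltn_ord i); rewrite p0 coef0 => /esym.
by rewrite /b inord_val.
Qed.

Variable b : nat -> F.
Hypotheses (bk : b k = 1) (bV : {in V, forall x, (linpoly k.+1 b).[x] = 0}).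

(** The left side is monic of degree [2 ^ k] and has the [2 ^ k] elements of [V] as roots. *)
Lemma linpoly_prod : linpoly k.+1 b = \prod_(x <- Vseq) ('X - x%:P).
Proof.
have coefk : (linpoly k.+1 b)`_(2 ^ k) = 1 by rewrite coef_linpoly.
have size_b : size (linpoly k.+1 b) = (2 ^ k).+1.
  apply/eqP; rewrite eqn_leq size_linpoly ltnNge; apply/negP => le.
  by move/eqP: coefk; rewrite nth_default // eq_sym oner_eq0.
rewrite {1}(@all_roots_prod_XsubC _ (linpoly k.+1 b) Vseq).
- by rewrite /lead_coef size_b /= coefk scale1r.
- by rewrite size_b size_Vseq.
- by apply/allP => x; rewrite mem_Vseq => /bV px; apply/rootP.
- by rewrite uniq_rootsE uniq_Vseq.
Qed.

(** With the root 0 split off, [b 0] becomes the constant term and [b 1] the derivative at 0. *)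
Let nonzero_prod : {poly F} := \prod_(x <- rem 0 Vseq) ('X - x%:P).

Let linpoly_split : linpoly k.+1 b = nonzero_prod * 'X.
Proof.
have in0 : 0 \in Vseq by rewrite mem_Vseq mem0v.
by rewrite linpoly_prod (perm_big _ (perm_to_rem in0)) big_cons subr0 mulrC.
Qed.

Let notin0 : 0 \notin rem 0 Vseq.
Proof. by rewrite (rem_filter _ uniq_Vseq) mem_filter /= eqxx. Qed.

Let nonzero_prod0 : nonzero_prod.[0] != 0.
Proof.
rewrite horner_prod prodf_seq_neq0; apply/allP => x xV /=.
rewrite hornerXsubC sub0r oppr_eq0; apply: contraNneq notin0 => x0.
by rewrite -[X in X \in _]x0; exact: xV.
Qed.

Lemma linpoly_coef0_neq0 : b 0%N != 0.
Proof.
have <- : (linpoly k.+1 b)`_(2 ^ 0) = b 0%N by rewrite coef_linpoly.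
by rewrite linpoly_split coefMX -horner_coef0.
Qed.

Lemma sum_inv_affine a : a \notin V ->
  \sum_(x in [set x : finvect_type F | (x : F) - a \in V]) (x : F)^-1 != 0.
Proof.
move=> aV; have aVs : a \notin Vseq by rewrite mem_Vseq.
have := deriv_prod_XsubC aVs; rewrite -linpoly_prod deriv_linpoly // hornerC => E.
have : \sum_(x <- Vseq) (a - x)^-1 != 0.
  by apply: contraNneq linpoly_coef0_neq0 => s0; rewrite E s0 mulr0.
suff -> : \sum_(x in [set x : finvect_type F | (x : F) - a \in V]) (x : F)^-1 =
  \sum_(x <- Vseq) (a - x)^-1 by [].
(* The reflection in [a] carries [V] onto its coset, as [V] is closed under negation. *)
rewrite sum_Vseq (reindex_inj (h := fun x : finvect_type F => (a : finvect_type F) - x)).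
  by apply: eq_bigl => x; rewrite !inE [_ - x - a]addrAC subrr sub0r rpredN.
by move=> x y /addrI/oppr_inj.
Qed.

Lemma sum_inv_linear : (0 < k)%N ->
  (\sum_(x in [set x : finvect_type F | (x : F) \in V]) (x : F)^-1 == 0) = (b 1 == 0).
Proof.
move=> k0.
have <- : (linpoly k.+1 b)`_(2 ^ 1) = b 1%N by rewrite coef_linpoly.
rewrite linpoly_split coefMX /=.
have := deriv_prod_XsubC notin0.
rewrite horner_coef0 coef_deriv mulr1n -/nonzero_prod => ->.
rewrite mulf_eq0 (negPf nonzero_prod0) /=.
rewrite -(sum_Vseq (fun x => x^-1)).
have in0 : 0 \in Vseq by rewrite mem_Vseq mem0v.
(* The convention [0^-1 = 0] removes the term at 0, leaving the logarithmic derivative of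
   [nonzero_prod] at 0 up to sign. *)
rewrite (perm_big _ (perm_to_rem in0)) big_cons invr0 /= add0r -oppr_eq0 -sumrN.
by congr (_ == 0); apply: eq_bigr => x _; rewrite sub0r invrN.
Qed.

End Subspace.

(** * The exchange of the coefficients of index 1 and [k - 1] *)

Lemma dickson_coef_eq0 (F : fieldType) (char2 : 2 \in [pchar F]) k (v : 'I_k -> F) s :
    (s <= k)%N -> \det (moore_mx v) != 0 ->
  dickson_coef v s = 0 <-> exists2 y : 'I_k -> F, (exists j, y j != 0) &
    forall i, (i <= k)%N -> i != s -> \sum_j v j ^+ (2 ^ i) * y j = 0.
Proof.
move=> sk dv; pose r (i : 'I_k.+1) j := v j ^+ (2 ^ i).
have dr : \det (\matrix_(i < k, j < k) r (lift ord_max i) j) != 0.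
  rewrite (_ : \matrix_(_, _) _ = moore_mx v) //.
  by apply/matrixP => i j; rewrite !mxE /r lift_max.
have := relation_coef_eq0 (Ordinal (sk : s < k.+1)%N) dr
  (b := fun i => dickson_coef v i) (dickson_coef_lead v) (dickson_coef_relation char2 v).
move=> /= ->; split=> -[y y0 ry]; exists y => // i.
  move=> ik is_; exact: (ry (Ordinal (ik : i < k.+1)%N)).
by move=> is_; apply: ry; rewrite // -ltnS.
Qed.

Lemma moore_neq0_exists (F : fieldType) k (v : 'I_k -> F) :
  (0 < k)%N -> \det (moore_mx v) != 0 -> exists j, v j != 0.
Proof.
move=> k0 dv; apply/existsP; apply: contraNT dv; rewrite negb_exists => /forallP v0.
apply/det0P; exists (const_mx 1).
  by apply/rV0Pn; exists (Ordinal k0); rewrite mxE oner_eq0.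
apply/rowP => j; rewrite !mxE big1 // => i _.
by rewrite !mxE (eqP (negbNE (v0 j))) expr0n expn_eq0 mulr0.
Qed.

Lemma dickson_coef_dual (F : fieldExtType 'F_2) k : (0 < k)%N ->
  (exists2 v : 'I_k -> F, \det (moore_mx v) != 0 & dickson_coef v 1 = 0) <->
  (exists2 u : 'I_k -> F, \det (moore_mx u) != 0 & dickson_coef u k.-1 = 0).
Proof.
move=> k0; have char2 := fieldExt_char2 F.
split=> [[v dv] | [u du]].
  case/(dickson_coef_eq0 char2 k0 dv) => y y0 perp.
  have dy := moore_dual_neq0 char2 k0 perp (pairing1_neq0 perp dv y0).
  exists y => //; apply/(dickson_coef_eq0 char2 (leq_pred k) dy).
  exists (fun j => v j ^+ (2 ^ k)); last exact: moore_dual_perp.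
  by have [j vj] := moore_neq0_exists k0 dv; exists j; rewrite expr2_eq0.
case/(dickson_coef_eq0 char2 (leq_pred k) du) => z [j0 zj0] perp.
(* The vector [z] has to be written as a [2 ^ k]-th power; squaring is injective on the finite
   field, hence bijective. *)
have root2 m (x : F) : exists y, y ^+ (2 ^ m) = x.
  elim: m x => [|m IH] x; first by exists x.
  pose sqr (t : finvect_type F) : finvect_type F := (t : F) ^+ 2.
  have inj_sqr : injective sqr.
    by move=> s t; rewrite /sqr -!(pFrobenius_autE char2) => /fmorph_inj.
  have [y Ey] := IH (invF inj_sqr x); exists y.
  by rewrite expnSr exprM Ey -[LHS]/(sqr _) f_invF.
have [w wE] : exists w : 'I_k -> F, forall j, w j ^+ (2 ^ k) = z j.
  exact: (fin_all_exists (fun j => root2 k (z j))).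
have w0 : exists j, w j != 0 by exists j0; rewrite -(expr2_eq0 k) wE.
have perp' i : (i <= k)%N -> i != k.-1 ->
    \sum_j u j ^+ (2 ^ i) * w j ^+ (2 ^ k) = 0.
  by move=> ik ik1; under eq_bigr do rewrite wE; apply: perp.
have dw := moore_codual_neq0 char2 k0 du w0 perp'.
exists w => //; apply/(dickson_coef_eq0 char2 k0 dw).
exists u; last exact: moore_codual_perp.
exact: moore_neq0_exists du.
Qed.

(** * Sums of [f_inv] over affine subspaces, and the equivalence *)

Lemma f_invE (F : fieldType) (x : F) : f_inv x = x^-1.
Proof. by rewrite /f_inv; case: eqP => [->|//]; rewrite invr0. Qed.

Section SumOverSpan.
Variables (F : fieldExtType 'F_2) (k : nat) (V : {vspace F}) (v : 'I_k -> F).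
Hypotheses (dimV : \dim V = k).
Hypothesis gen : {in V, forall x, exists e : 'I_k -> 'F_2, x = \sum_j e j *: v j}.

Let vanish : {in V, forall x, (linpoly k.+1 (dickson_coef v)).[x] = 0}.
Proof.
move=> x /gen[e ->]; rewrite horner_linpoly_comb big1 // => j _.
by rewrite horner_linpoly dickson_coef_relation ?scaler0 //; apply: fieldExt_char2.
Qed.

Lemma sum_f_inv_eq0 a : (0 < k)%N ->
  (\sum_(x in [set x : finvect_type F | (x : F) - a \in V]) f_inv (x : F) == 0) =
  (a \in V) && (dickson_coef v 1 == 0).
Proof.
move=> k0; under eq_bigr do rewrite f_invE.
have lead := dickson_coef_lead v.
have [aV|aV] := boolP (a \in V); last first.
  by apply/negbTE; apply: (sum_inv_affine dimV lead vanish).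
rewrite -(sum_inv_linear dimV lead vanish k0) /=; congr (_ == _).
by apply: eq_bigl => x; rewrite !inE rpredBr.
Qed.

End SumOverSpan.

Lemma vspace_basis_fun (F : fieldExtType 'F_2) k (V : {vspace F}) : \dim V = k ->
  exists v : 'I_k -> F,
    {in V, forall x, exists e : 'I_k -> 'F_2, x = \sum_j e j *: v j}.
Proof.
move=> <-; exists (fun j => (vbasis V)`_j) => x xV.
by exists (fun j => coord (vbasis V) j x); apply: coord_vbasis.
Qed.

(** Coefficients in ['F_2] are fixed by Frobenius, so a linear relation among the [v j] is one among
    the columns of the Moore matrix. *)
Lemma moore_neq0_free (F : fieldExtType 'F_2) k (v : 'I_k -> F) :
  \det (moore_mx v) != 0 -> free [tuple v j | j < k].
Proof.
move=> dv; apply/freeP => e; under eq_bigr do rewrite -tnth_nth tnth_mktuple.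
move=> ev j; suff /eqP : (e j)%:A = 0 :> F by rewrite scaler_eq0 oner_eq0 orbF => /eqP.
move: j; apply: (det_neq0_col dv (y := fun j => (e j)%:A)) => i.
rewrite -[RHS](_ : 0 ^+ (2 ^ i) = 0); last by rewrite expr0n expn_eq0.
rewrite -[in RHS]ev expr_sum_char2 ?fieldExt_char2 //; apply: eq_bigr => j _.
by rewrite mxE exprZn F2_expr2 -scalerAr mulr1.
Qed.

Lemma not_sum_free_f_inv (F : fieldExtType 'F_2) k : (0 < k)%N ->
  ~ sum_free k (@f_inv F) <->
  exists2 v : 'I_k -> F, \det (moore_mx v) != 0 & dickson_coef v 1 = 0.
Proof.
move=> k0; split=> [not_sf | [v dv b1] sf]; last first.
  pose V := <<[tuple v j | j < k]>>%VS.
  have dimV : \dim V = k by have /eqP := moore_neq0_free dv; rewrite size_tuple.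
  have gen : {in V, forall x, exists e : 'I_k -> 'F_2, x = \sum_j e j *: v j}.
    move=> x xV; exists (fun j => coord [tuple v j | j < k] j x).
    rewrite {1}(coord_span xV); apply: eq_bigr => j _.
    by rewrite -tnth_nth tnth_mktuple.
  apply: (sf [set x : finvect_type F | (x : F) - 0 \in V]); first by exists 0, V.
  by apply/eqP; rewrite (sum_f_inv_eq0 dimV gen) // mem0v b1 eqxx.
(* The negated hypothesis supplies no subspace; existence of [v] is decided over a finite type
   instead, and its failure would yield sum-freeness. *)
have [/existsP[v /andP[dv /eqP b1]] | none] := boolP [exists v : {ffun 'I_k -> finvect_type F},
    (\det (moore_mx (v : 'I_k -> F)) != 0) && (dickson_coef (v : 'I_k -> F) 1 == 0)].
  by exists v.
case: not_sf => _ [a [V [dimV ->]]] /eqP sum0.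
have [v gen] := vspace_basis_fun dimV.
pose w : {ffun 'I_k -> finvect_type F} := [ffun j => v j].
have genw : {in V, forall x, exists e : 'I_k -> 'F_2, x = \sum_j e j *: (w j : F)}.
  by move=> x /gen[e ->]; exists e; apply: eq_bigr => j _; rewrite ffunE.
move: sum0; rewrite (sum_f_inv_eq0 dimV genw) // => /andP[_ b1].
by case/existsP: none; exists w; rewrite (moore_basis_neq0 dimV genw).
Qed.

Theorem theorem3p11 (n k : nat) (F : fieldExtType 'F_2) :
  (0 < n)%N -> (0 < k)%N -> \dim {:F} = n ->
  ~ sum_free k (@f_inv F) <->
  exists u : 'I_k -> F,
    eval_at (Moore_det k) u <> 0 /\ eval_at (Theta k) u = 0.
Proof.
move=> _ k0 _; rewrite not_sum_free_f_inv // dickson_coef_dual //.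
split=> [[u du Tu] | [u []]].
  by exists u; rewrite eval_Moore eval_Theta //; split=> //; apply/eqP.
by rewrite eval_Moore eval_Theta // => /eqP; exists u.
Qed.
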